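(* For every prime $m\geq 5$ and every $G\in\{\Gamma(\mathbb{Z}_4),\Gamma(\mathbb{Z}_6),\Gamma(\mathbb{Z}_9),\overline{\Gamma(\mathbb{Z}_6)},\overline{\Gamma(\mathbb{Z}_9)}\}$, the join graph $\Gamma(\mathbb{Z}_{3m})+G$ does not admit a distance antimagic labeling.
   Context: For an integer $n \geq 2$, the zero-divisor graph $\Gamma(\mathbb{Z}_n)$ is the simple graph whose vertex set is the set of nonzero zero-divisors of the ring $\mathbb{Z}_n$, two distinct vertices $u,v$ being adjacent iff $uv \equiv 0 \pmod n$. $\overline{H}$ denotes the complement of a graph $H$. For graphs $G,H$, the join $G+H$ is the graph obtained from the disjoint union of $G$ and $H$ by adding every edge between a vertex of $G$ and a vertex of $H$. A distance antimagic labeling (DAML) of a graph $G$ with $N$ vertices is a bijection $f:V(G)\to\{1,\dots,N\}$ such that the weights $w(v)=\sum_{u\in N(v)} f(u)$, where $N(v)$ is the open neighbourhood of $v$, are pairwise distinct over all vertices $v$. A graph admits DAML if such a labeling exists. *)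

(* Defs.v *)
From mathcomp Require Import all_boot all_algebra.

Set Implicit Arguments.
Unset Strict Implicit.
Unset Printing Implicit Defensive.

Import GRing.Theory.

(** Finite simple graphs. *)
Record sgraph := SGraph {
  vertex :> finType;
  adj : rel vertex;
  adj_sym : symmetric adj;
  adj_irr : irreflexive adj
}.

Section Complement.
Variable G : sgraph.

Definition compl_adj : rel G := fun u v => (u != v) && ~~ adj u v.

Lemma compl_adj_sym : symmetric compl_adj.
Proof. by move=> u v; rewrite /compl_adj eq_sym adj_sym. Qed.

Lemma compl_adj_irr : irreflexive compl_adj.
Proof. by move=> u; rewrite /compl_adj eqxx. Qed.

Definition compl_graph : sgraph := SGraph compl_adj_sym compl_adj_irr.
End Complement.

Section Join.
Variables G H : sgraph.

Definition join_adj : rel (G + H)%type := fun x y =>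
  match x, y with
  | inl u, inl v => adj u v
  | inr u, inr v => adj u v
  | _, _ => true
  end.

Lemma join_adj_sym : symmetric join_adj.
Proof. by move=> [u|u] [v|v] //=; rewrite adj_sym. Qed.

Lemma join_adj_irr : irreflexive join_adj.
Proof. by move=> [u|u] /=; rewrite adj_irr. Qed.

Definition join_graph : sgraph := SGraph join_adj_sym join_adj_irr.
End Join.

(** ['Z_n] is the ring of integers modulo [n] only for [n >= 2]; the
    definitions below are meant for such [n]. *)
Section ZeroDivisorGraph.
Variable n : nat.
Local Open Scope ring_scope.

Definition nonzero_zero_divisor : pred 'Z_n :=
  fun x => (x != 0) && [exists y : 'Z_n, (y != 0) && (x * y == 0)].

Definition zdiv_adj : rel {x : 'Z_n | nonzero_zero_divisor x} :=
  fun u v => (u != v) && (val u * val v == 0).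

Lemma zdiv_adj_sym : symmetric zdiv_adj.
Proof. by move=> u v; rewrite /zdiv_adj eq_sym mulrC. Qed.

Lemma zdiv_adj_irr : irreflexive zdiv_adj.
Proof. by move=> u; rewrite /zdiv_adj eqxx. Qed.

Definition zero_divisor_graph : sgraph := SGraph zdiv_adj_sym zdiv_adj_irr.
End ZeroDivisorGraph.

Section DistanceAntimagic.
Variable G : sgraph.

Definition weight (f : G -> nat) (v : G) : nat := \sum_(u : G | adj v u) f u.

(** The first three conditions say that [f] is a bijection from the vertices
    onto [{1, ..., #|G|}]. *)
Definition is_DAML (f : G -> nat) : Prop :=
  [/\ forall v : G, 1 <= f v <= #|G|,
      injective f,
      forall k : nat, 1 <= k <= #|G| -> exists v : G, f v = k
    & injective (weight f)].

Definition admits_DAML : Prop := exists f : G -> nat, is_DAML f.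
End DistanceAntimagic.

(* Main.v *)
Require Import Defs.
From mathcomp Require Import all_boot all_algebra.

(** In [Z_(3m)] the vertices [3] and [-3] are distinct, non-adjacent and have
    the same annihilator, hence the same open neighbourhood.  This survives the
    join with any graph, so the two vertices always get equal weights. *)

Import GRing.Theory.

Lemma false_twins_no_DAML (G : sgraph) (u v : G) :
  u != v -> adj u =1 adj v -> ~ admits_DAML G.
Proof.
move=> neq_uv twins [f [_ _ _ weight_inj]].
by case/eqP: neq_uv; apply: weight_inj; apply: eq_bigl.
Qed.

Lemma false_twins_join (G H : sgraph) (u v : G) :
  adj u =1 adj v ->
  @adj (join_graph G H) (inl u) =1 @adj (join_graph G H) (inl v).
Proof. by move=> twins [w|w] //=; apply: twins. Qed.

Local Open Scope ring_scope.

Lemma nonzero_zero_divisorN n (x : 'Z_n) :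
  nonzero_zero_divisor (- x) = nonzero_zero_divisor x.
Proof.
rewrite /nonzero_zero_divisor oppr_eq0; congr (_ && _).
by apply: eq_existsb => y; rewrite mulNr oppr_eq0.
Qed.

(** [u] and [-u] have the same annihilator. As [u * u] is nonzero, neither lies in it, so the clause
    excluding equal vertices in [zdiv_adj] never separates their neighbourhoods. *)
Lemma zdiv_adj_opp n (u v : zero_divisor_graph n) :
  val v = - val u -> val u * val u != 0 -> adj u =1 adj v.
Proof.
move=> vE uu_neq0 w; rewrite /= /zdiv_adj vE mulNr oppr_eq0.
have [uw0|] := eqVneq (val u * val w) 0; last by rewrite !andbF.
have -> : u != w by apply: contraNneq uu_neq0 => {2}->; rewrite uw0.
suff -> : v != w by [].
apply: contraNneq uu_neq0 => vw.
by rewrite -oppr_eq0 -mulrN -vE vw uw0.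
Qed.

Lemma Zp_natr_neq0 n k : (0 < k < n)%N -> (k%:R : 'Z_n) != 0.
Proof.
case/andP=> k_gt0 lt_kn; rewrite -val_eqE /= val_Zp_nat.
  by rewrite modn_small // -lt0n.
(* The remaining goal is [1 < n], under which ['Z_n] really is the ring of integers modulo [n]. *)
exact: leq_ltn_trans k_gt0 lt_kn.
Qed.

Lemma zero_divisor_3 m : (1 < m)%N -> @nonzero_zero_divisor (3 * m) 3%:R.
Proof.
move=> m_gt1; have m_gt0 := ltnW m_gt1.
rewrite /nonzero_zero_divisor Zp_natr_neq0 ?ltn_Pmulr //=.
apply/existsP; exists m%:R; rewrite Zp_natr_neq0 ?m_gt0 ?ltn_Pmull //=.
by rewrite -natrM pchar_Zp // (leq_trans m_gt1) // leq_pmull.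
Qed.

Local Close Scope ring_scope.

Theorem theorem2p3 (m : nat) (G : sgraph) :
  prime m -> 5 <= m ->
  [\/ G = zero_divisor_graph 4,
      G = zero_divisor_graph 6,
      G = zero_divisor_graph 9 |
      G = compl_graph (zero_divisor_graph 6) \/
      G = compl_graph (zero_divisor_graph 9)] ->
  ~ admits_DAML (join_graph (zero_divisor_graph (3 * m)) G).
Proof.
move=> m_prime m_ge5 _.
(* This bound serves twice: [3 * 3 = 9] must be nonzero for the twin property, and [3 - (-3) = 6]
   must be nonzero for the twins to be distinct. *)
have lt9 : 9 < 3 * m by apply: leq_trans (leq_mul (leqnn 3) m_ge5).
have zd3 := zero_divisor_3 m (prime_gt1 m_prime).
have zdN3 : nonzero_zero_divisor (- 3%:R : 'Z_(3 * m))%R.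
  by rewrite nonzero_zero_divisorN.
pose u : zero_divisor_graph (3 * m) := exist _ 3%:R%R zd3.
pose v : zero_divisor_graph (3 * m) := exist _ (- 3%:R)%R zdN3.
have twins : adj u =1 adj v.
  by apply: zdiv_adj_opp => //=; rewrite -natrM Zp_natr_neq0.
apply: (false_twins_no_DAML (join_graph _ G) (inl u) (inl v)); last exact: false_twins_join.
have : (6%:R : 'Z_(3 * m))%R != 0%R by rewrite Zp_natr_neq0 ?(ltn_trans _ lt9).
apply: contraNneq => eq_uv.
have u_eq_v : val u = val v by rewrite (inl_inj eq_uv).
(* With 6 split as [3 + 3], replacing only the first summand by [-3] gives 0. *)
by rewrite (natrD _ 3 3) [X in (X + _)%R]u_eq_v addNr.
Qed.
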